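(* Consider any equilibrium $\beta^*=(\eta^*,\omega^*,x^{M,*},p^{c,*})$ of the closed-loop power network system described in the context, and let $p^{M,*}=(p^{M,*}_j)_{j\in G}$ be the corresponding equilibrium value of $p^M$. If the gains satisfy $k_{c,j}=\frac{1}{q_jK_j}$ for all $j\in G$, then $p^{M,*}$ is optimal for the optimal generation regulation (OGR) problem $$\min_{p^M}\ \sum_{j\in G}\tfrac12 q_j(p^M_j)^2\quad\text{subject to}\quad \sum_{j\in G}p^M_j=\sum_{j\in N}p^L_j .$$
   Context: **Network.** $(N,E)$ is a connected graph, $N=\{1,\dots,|N|\}$ the buses, $E\subseteq N\times N$ the lines, each line given one arbitrary direction (if $(i,j)\in E$ then $(j,i)\notin E$). $N$ is the disjoint union of $G=\{1,\dots,|G|\}$ (buses with inertia, nonempty) and $L=\{|G|+1,\dots,|N|\}$ (buses without inertia). $i:i\to j$ and $k:j\to k$ denote the predecessors and successors of bus $j$ in $(N,E)$. Constants: $M_j>0$ ($j\in G$), $\Lambda_j>0$ ($j\in N$), $B_{ij}=B_{ji}>0$ ($(i,j)\in E$), demands $p^L_j\in\mathbb R$ ($j\in N$), cost coefficients $q_j>0$ ($j\in G$). **Network dynamics.** $\dot\eta_{ij}=\omega_i-\omega_j$ for $(i,j)\in E$; $M_j\dot\omega_j=-p^L_j+p^M_j-\Lambda_j\omega_j-\sum_{k:j\to k}p_{jk}+\sum_{i:i\to j}p_{ij}$ for $j\in G$; $0=-p^L_j-\Lambda_j\omega_j-\sum_{k:j\to k}p_{jk}+\sum_{i:i\to j}p_{ij}$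 for $j\in L$; $p_{ij}=B_{ij}\sin\eta_{ij}$ for $(i,j)\in E$. **Generation dynamics.** For $j\in G$: $\dot x^M_j=A_jx^M_j+B_ju_j$, $p^M_j=C_jx^M_j+D_ju_j$, with $x^M_j(t)\in\mathbb R^{n_j}$, $n_j\ge 0$, $u_j(t),p^M_j(t)\in\mathbb R$, $A_j\in\mathbb R^{n_j\times n_j}$ Hurwitz, $B_j\in\mathbb R^{n_j}$, $C_j\in\mathbb R^{1\times n_j}$, $D_j\in\mathbb R$. Put $K_j=-C_jA_j^{-1}B_j+D_j$ (static gain). **DADOC controller.** $(G,\tilde E)$ is a connected (undirected) communication graph. For $j\in G$: $\gamma_j\dot p^c_j=p^M_j-K_ju_j-k_{f,j}\omega_j+\sum_{i:(i,j)\in\tilde E}\alpha_{ij}(p^c_i-p^c_j)$, $\quad u_j=k_{c,j}p^c_j-k_{d,j}\omega_j$, where the sum is over the neighbors $i$ of $j$ in $(G,\tilde E)$, and $\gamma_j,k_{f,j},k_{c,j},k_{d,j}>0$, $\alpha_{ij}=\alpha_{ji}>0$ are constants. An equilibrium of the closed-loop system is a point $\beta^*=(\eta^*,\omega^*,x^{M,*},p^{c,*})$ at which all time derivatives vanish (and the algebraic equations hold). *)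

(* Defs.v *)
From HB Require Import structures.
From mathcomp Require Import all_boot all_order all_algebra.
From mathcomp Require Import reals trigo.
From mathcomp Require Import complex.

Set Implicit Arguments.
Unset Strict Implicit.
Unset Printing Implicit Defensive.

Import Order.TTheory GRing.Theory Num.Theory.
Local Open Scope ring_scope.

(* [e] is read as an undirected graph: a path may follow an edge in either
   direction. *)
Definition connected_graph (T : finType) (e : rel T) : Prop :=
  forall x y : T, connect (fun a b => e a b || e b a) x y.

Definition Hurwitz (R : realType) (n : nat) (A : 'M[R]_n) : Prop :=
  forall z : R[i],
    eigenvalue (map_mx (real_complex R) A) z -> complex.Re z < 0.

(* The buses are 'I_(g + l): [lshift l j], j : 'I_g, are the buses with
   inertia, and [rshift g j], j : 'I_l, are those without.  Line-indexed
   families are total functions of two buses, of which only the values at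
   (i, j) with [line i j] are used, except that [susceptance] is also used
   at the reversed pair in [susceptance_sym]. *)
Record network (R : realType) (g l : nat) := Network {
  line : rel 'I_(g + l);
  inertia : 'I_g -> R;
  damping : 'I_(g + l) -> R;
  susceptance : 'I_(g + l) -> 'I_(g + l) -> R;
  demand : 'I_(g + l) -> R;
  cost_coef : 'I_g -> R;
  inertia_buses_nonempty : (0 < g)%N;
  line_oriented : forall i j, line i j -> ~~ line j i;
  line_connected : connected_graph line;
  inertia_gt0 : forall j, 0 < inertia j;
  damping_gt0 : forall j, 0 < damping j;
  susceptance_sym : forall i j, line i j -> susceptance i j = susceptance j i;
  susceptance_gt0 : forall i j, line i j -> 0 < susceptance i j;
  cost_coef_gt0 : forall j, 0 < cost_coef j
}.

Record generation (R : realType) (g : nat) := Generation {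
  gen_dim : 'I_g -> nat;
  gen_A : forall j, 'M[R]_(gen_dim j);
  gen_B : forall j, 'cV[R]_(gen_dim j);
  gen_C : forall j, 'rV[R]_(gen_dim j);
  gen_D : 'I_g -> R;
  gen_A_Hurwitz : forall j, Hurwitz (gen_A j)
}.

Definition static_gain (R : realType) (g : nat) (P : generation R g)
    (j : 'I_g) : R :=
  - (gen_C P j *m invmx (gen_A P j) *m gen_B P j) 0 0 + gen_D P j.

Record controller (R : realType) (g : nat) := Controller {
  comm : rel 'I_g;
  comm_weight : 'I_g -> 'I_g -> R;
  gamma : 'I_g -> R;
  k_f : 'I_g -> R;
  k_c : 'I_g -> R;
  k_d : 'I_g -> R;
  comm_sym : symmetric comm;
  comm_connected : connected_graph comm;
  comm_weight_sym :
    forall i j, comm i j -> comm_weight i j = comm_weight j i;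
  comm_weight_gt0 : forall i j, comm i j -> 0 < comm_weight i j;
  gamma_gt0 : forall j, 0 < gamma j;
  k_f_gt0 : forall j, 0 < k_f j;
  k_c_gt0 : forall j, 0 < k_c j;
  k_d_gt0 : forall j, 0 < k_d j
}.

Record state (R : realType) (g l : nat) (P : generation R g) := State {
  eta : 'I_(g + l) -> 'I_(g + l) -> R;
  omega : 'I_(g + l) -> R;
  xM : forall j : 'I_g, 'cV[R]_(gen_dim P j);
  pc : 'I_g -> R
}.

Definition zero_state (R : realType) (g l : nat) (P : generation R g) :
    state l P :=
  State (fun _ _ => 0) (fun _ => 0) (fun _ => 0) (fun _ => 0).

Section ClosedLoop.
Variables (R : realType) (g l : nat).
Variables (S : network R g l) (P : generation R g) (F : controller R g).
Implicit Types b db : state l P.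

Definition line_flow b (i j : 'I_(g + l)) : R :=
  susceptance S i j * sin (eta b i j).

Definition net_inflow b (j : 'I_(g + l)) : R :=
  - (\sum_(k | line S j k) line_flow b j k)
  + \sum_(i | line S i j) line_flow b i j.

Definition gen_input b (j : 'I_g) : R :=
  k_c F j * pc b j - k_d F j * omega b (lshift l j).

Definition gen_power b (j : 'I_g) : R :=
  (gen_C P j *m xM b j) 0 0 + gen_D P j * gen_input b j.

(* The differential-algebraic equations of the closed loop, as a relation
   between a point [b] and the vector [db] of its time derivatives.  The
   frequencies of the buses without inertia are algebraic variables, so the
   corresponding entries of [omega db] do not occur. *)
Record closed_loop db b : Prop := ClosedLoop {
  angle_eq : forall i j, line S i j -> eta db i j = omega b i - omega b j;
  inertia_bus_eq : forall j : 'I_g,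
    inertia S j * omega db (lshift l j)
    = - demand S (lshift l j) + gen_power b j
      - damping S (lshift l j) * omega b (lshift l j)
      + net_inflow b (lshift l j);
  inertialess_bus_eq : forall j : 'I_l,
    0 = - demand S (rshift g j)
        - damping S (rshift g j) * omega b (rshift g j)
        + net_inflow b (rshift g j);
  generation_eq : forall j : 'I_g,
    xM db j = gen_A P j *m xM b j + gen_input b j *: gen_B P j;
  controller_eq : forall j : 'I_g,
    gamma F j * pc db j
    = gen_power b j - static_gain P j * gen_input b j
      - k_f F j * omega b (lshift l j)
      + \sum_(i | comm F i j) comm_weight F i j * (pc b i - pc b j)
}.

Definition equilibrium b : Prop := closed_loop (zero_state l P) b.

End ClosedLoop.

Section OptimalGenerationRegulation.
Variables (R : realType) (g l : nat) (S : network R g l).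
Implicit Types p : 'I_g -> R.

Definition OGR_cost p : R := \sum_j 2^-1 * cost_coef S j * p j ^+ 2.

Definition OGR_feasible p : Prop := \sum_j p j = \sum_j demand S j.

Definition OGR_optimal p : Prop :=
  OGR_feasible p /\ forall p', OGR_feasible p' -> OGR_cost p <= OGR_cost p'.

End OptimalGenerationRegulation.

(* Main.v *)
(* At an equilibrium the angle equations force a common frequency [w], and the
   generators sit at [p_j = K_j u_j]. Summing the controller equations cancels
   the symmetric communication terms, so [(\sum_j k_f j) w = 0] and [w = 0].
   Then [pc] is harmonic for the weighted communication Laplacian, hence
   constant, say [c], and [q_j p_j = c] for every [j]: all marginal costs agree,
   which is optimal by convexity. Feasibility is the sum of the bus equations. *)
Require Import Defs.
From mathcomp Require Import all_boot all_order all_algebra.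
From mathcomp Require Import reals.
From mathcomp Require Import complex ring lra.

Set Implicit Arguments.
Unset Strict Implicit.

Import Order.TTheory GRing.Theory Num.Theory.
Local Open Scope ring_scope.

Lemma connected_graph_const (T : finType) (U : Type) (e : rel T) (f : T -> U) :
  connected_graph e -> (forall i j, e i j -> f i = f j) ->
  forall i j, f i = f j.
Proof.
move=> ce fe i j; have /connectP [s] := ce i j.
elim: s i => [|k s IHs] i /=; first by move=> _ ->.
(* A path step may run along an edge or against it, hence the two rewriting directions. *)
move=> /andP[/orP[/fe ->|/fe <-] ks] js; exact: IHs.
Qed.

(** Exchanging the two sums turns the total into its own opposite. *)
Lemma sum_antisym (R : numDomainType) (T : finType) (f : T -> T -> R) :
  (forall i j, f i j = - f j i) -> \sum_j \sum_i f i j = 0.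
Proof.
move=> fN; apply/eqP; rewrite -eqNr -sumrN; apply/eqP.
rewrite [RHS]exchange_big; apply: eq_bigr => j _.
by rewrite -sumrN; apply: eq_bigr => i _; rewrite [RHS]fN.
Qed.

Section WeightedLaplacian.
Variables (R : realFieldType) (T : finType) (e : rel T) (w : T -> T -> R).
Hypotheses (e_sym : symmetric e).
Hypotheses (w_sym : forall i j, e i j -> w i j = w j i).
Variable x : T -> R.

Lemma sum_laplacian : \sum_j \sum_(i | e i j) w i j * (x i - x j) = 0.
Proof.
under eq_bigr do rewrite big_mkcond.
apply: sum_antisym => i j; rewrite [e j i]e_sym.
case: ifP => [/w_sym ->|_]; last by rewrite oppr0.
by ring.
Qed.

(** Summation by parts: moving the right side over leaves the terms [w i j * (x i ^+ 2 - x j ^+ 2)],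
    which are antisymmetric. *)
Lemma laplacian_energy :
  \sum_j \sum_(i | e i j) w i j * (x i - x j) ^+ 2
  = - 2 * \sum_j x j * \sum_(i | e i j) w i j * (x i - x j).
Proof.
apply/eqP; rewrite mulNr -addr_eq0 mulr_sumr -big_split /=; apply/eqP.
under eq_bigr do rewrite !mulr_sumr -big_split big_mkcond /=.
apply: sum_antisym => i j; rewrite [e j i]e_sym.
case: ifP => [/w_sym ->|_]; last by rewrite oppr0.
by ring.
Qed.

Lemma harmonic_const :
  connected_graph e -> (forall i j, e i j -> 0 < w i j) ->
  (forall j, \sum_(i | e i j) w i j * (x i - x j) = 0) ->
  forall i j, x i = x j.
Proof.
move=> ce w_gt0 xh; apply: connected_graph_const ce _ => i j eij.
have tge0 k m : e k m -> 0 <= w k m * (x k - x m) ^+ 2.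
  by move=> ekm; rewrite mulr_ge0 ?sqr_ge0 // ltW ?w_gt0.
(* Harmonicity makes the energy zero; its terms are nonnegative, so the one at the edge [i], [j]
   vanishes. *)
have := laplacian_energy.
under [X in _ = _ * X]eq_bigr do rewrite xh mulr0.
rewrite big1_eq mulr0 => /eqP.
rewrite psumr_eq0 => [|m _]; last by apply: sumr_ge0 => k; apply: tge0.
move=> /allP /(_ j (mem_index_enum _)) /=.
rewrite psumr_eq0 => [|k]; last exact: tge0.
move=> /allP /(_ i (mem_index_enum _)); rewrite eij /=.
by rewrite mulf_eq0 gt_eqF ?w_gt0 //= sqrf_eq0 subr_eq0 => /eqP.
Qed.

End WeightedLaplacian.

(** A nontrivial kernel would make 0 a complex eigenvalue, whose real part is not negative. *)
Lemma Hurwitz_unitmx (R : realType) (n : nat) (A : 'M[R]_n) :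
  Hurwitz A -> A \in unitmx.
Proof.
move=> HA; apply/negPn/negP; rewrite -row_free_unit -kermx_eq0 => kA.
suff /HA : eigenvalue (map_mx (real_complex R) A) 0 by rewrite /= ltxx.
by rewrite /eigenvalue /eigenspace raddf0 subr0 -map_kermx map_mx_eq0.
Qed.

(** Each line flow leaves one bus and enters another, so it is counted once with each sign. *)
Lemma sum_net_inflow (R : realType) (g l : nat) (S : network R g l)
    (P : generation R g) (b : state l P) : \sum_j net_inflow S b j = 0.
Proof.
rewrite big_split /= sumrN [X in _ + X](exchange_big_dep xpredT) //=.
by rewrite addNr.
Qed.

Lemma equal_marginal_cost_optimal (R : realType) (g l : nat)
    (S : network R g l) (p : 'I_g -> R) (c : R) :
  OGR_feasible S p -> (forall j, cost_coef S j * p j = c) -> OGR_optimal S p.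
Proof.
move=> pF pc; split=> // p' p'F.
(* [c] acts as the Lagrange multiplier: the first-order cost change vanishes because both totals
   equal the demand. *)
have c0 : \sum_j c * (p' j - p j) = 0.
  by rewrite -mulr_sumr sumrB p'F pF subrr mulr0.
rewrite -subr_ge0 /OGR_cost -sumrB -[leLHS]c0; apply: ler_sum => j _.
rewrite -(pc j) -subr_ge0.
have -> : 2^-1 * cost_coef S j * p' j ^+ 2 - 2^-1 * cost_coef S j * p j ^+ 2
    - cost_coef S j * p j * (p' j - p j)
  = 2^-1 * cost_coef S j * (p' j - p j) ^+ 2 by field.
apply: mulr_ge0 (sqr_ge0 _); apply: mulr_ge0; first by rewrite invr_ge0.
exact/ltW/cost_coef_gt0.
Qed.

Section Equilibrium.
Variables (R : realType) (g l : nat).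
Variables (S : network R g l) (P : generation R g) (F : controller R g).
Variables (b : state l P) (Hb : equilibrium S F b).

Lemma equilibrium_gen_power j :
  gen_power F b j = static_gain P j * gen_input F b j.
Proof.
have uA := Hurwitz_unitmx (@gen_A_Hurwitz _ _ P j).
have /esym /= /eqP := generation_eq Hb j; rewrite addr_eq0 => /eqP Ax.
(* Inserting [invmx A *m A] before the state exposes [A *m x], which equilibrium equates to
   [- u *: B]. *)
have -> : gen_power F b j = (gen_C P j *m
    (invmx (gen_A P j) *m (gen_A P j *m xM b j))) 0 0
    + gen_D P j * gen_input F b j by rewrite mulKmx.
rewrite Ax /static_gain !mulmxN -!scalemxAr mulmxA !mxE.
by ring.
Qed.

Lemma equilibrium_omega j : omega b j = 0.
Proof.
have omega_const : forall i k, omega b i = omega b k.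
  apply: connected_graph_const (line_connected S) _ => i k Eik.
  by apply/eqP; rewrite -subr_eq0; have /= <- := angle_eq Hb Eik.
have : \sum_k k_f F k * omega b j = 0.
  rewrite -[RHS](sum_laplacian (@comm_sym _ _ F) (@comm_weight_sym _ _ F)
    (pc b)).
  apply: eq_bigr => k _; have /= := controller_eq Hb k.
  rewrite equilibrium_gen_power (omega_const _ j) mulr0; lra.
rewrite -mulr_suml => /eqP; rewrite mulf_eq0 => /orP[|/eqP //].
(* If the sum of the [k_f] were zero, each would vanish, but some bus has inertia and its [k_f] is
   positive. *)
rewrite psumr_eq0 => [/allP /(_ _ (mem_index_enum _)) kf0|k _]; last first.
  exact/ltW/k_f_gt0.
by have := kf0 (Ordinal (inertia_buses_nonempty S)); rewrite gt_eqF ?k_f_gt0.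
Qed.

Lemma equilibrium_pc i j : pc b i = pc b j.
Proof.
apply: (harmonic_const (@comm_sym _ _ F) (@comm_weight_sym _ _ F)
  (@comm_connected _ _ F) (@comm_weight_gt0 _ _ F)) => k.
have /= := controller_eq Hb k.
rewrite equilibrium_gen_power equilibrium_omega; lra.
Qed.

Lemma equilibrium_feasible : OGR_feasible S (gen_power F b).
Proof.
rewrite /OGR_feasible; have := sum_net_inflow S b.
rewrite !big_split_ord /=.
(* At zero frequency the bus equations express each inflow as demand minus generation. *)
under eq_bigr => j _.
  have -> : net_inflow S b (lshift l j)
      = demand S (lshift l j) - gen_power F b j.
    have /= := inertia_bus_eq Hb j; rewrite equilibrium_omega; lra.
  over.
under [X in _ + X]eq_bigr => j _.
  have -> : net_inflow S b (rshift g j) = demand S (rshift g j).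
    have /= := inertialess_bus_eq Hb j; rewrite equilibrium_omega; lra.
  over.
rewrite sumrB; lra.
Qed.

End Equilibrium.

Theorem proposition1 (R : realType) (g l : nat)
    (S : network R g l) (P : generation R g) (F : controller R g)
    (b : state l P) (Hb : equilibrium S F b)
    (Hkc : forall j : 'I_g, k_c F j = 1 / (cost_coef S j * static_gain P j)) :
  OGR_optimal S (gen_power F b).
Proof.
pose j0 := Ordinal (inertia_buses_nonempty S).
apply: (equal_marginal_cost_optimal (c := pc b j0)) => [|j].
  exact: equilibrium_feasible Hb.
rewrite (equilibrium_gen_power Hb) /gen_input.
rewrite (equilibrium_omega Hb) mulr0 subr0.
rewrite (equilibrium_pc Hb j j0) Hkc.
(* [K_j = 0] would give [k_c j = 1 / 0 = 0]. *)
have qK0 : cost_coef S j * static_gain P j != 0.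
  apply/negP => /eqP qK; have := k_c_gt0 F j.
  by rewrite Hkc qK invr0 mulr0 ltxx.
by rewrite !mulrA mulr1 divff // mul1r.
Qed.
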